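(* Let $\sum_{n=1}^\infty a_n$ be a series of strictly positive real numbers. Then $\sum_{n=1}^\infty a_n$ diverges if and only if the topological space $\mathbb{N}_{a_n}$ is connected.
   Context: $\mathbb{N}=\{1,2,3,\dots\}$. For a series $\sum_{n=1}^\infty a_n$ of strictly positive real numbers and $A\subseteq\mathbb{N}$, write $\sum_A a_n=\sum_{n\in A}a_n\in[0,\infty]$. $\mathbb{N}_{a_n}$ denotes the set $\mathbb{N}$ with the topology whose closed sets are exactly $\mathbb{N}$ itself and all $A\subseteq\mathbb{N}$ with $\sum_A a_n<\infty$. *)

(* Defs.v *)
From HB Require Import structures.
From mathcomp Require Import all_boot all_order all_algebra.
From mathcomp Require Import all_classical all_reals.
From mathcomp Require Import ereal esum topology normedtype sequences.

Set Implicit Arguments.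
Unset Strict Implicit.
Unset Printing Implicit Defensive.

Import Order.TTheory GRing.Theory Num.Theory.
Import numFieldNormedType.Exports.

Local Open Scope classical_set_scope.
Local Open Scope ring_scope.

Definition posnat := {n : nat | (0 < n)%N}.

(* The series is given by a : nat -> R, of which only a 1, a 2, ... matter:
   a 0 is never used. *)
Definition sum_over (R : realType) (a : nat -> R) (A : set posnat) : \bar R :=
  \esum_(n in A) (a (val n))%:E.

Definition series_closed (R : realType) (a : nat -> R) (A : set posnat) : Prop :=
  A = setT \/ (sum_over a A < +oo)%E.

(* The carrier is just posnat; the sequence a is a phantom parameter that
   selects the topology. *)
Definition series_space (R : realType) (a : nat -> R) : Type := posnat.

(* No sign condition on a is needed for these sets to form a topology: esum is
   the supremum of the sums over finite subsets, the empty one included, hence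
   it is nonnegative, monotone and subadditive in the set. *)
Section SeriesTopology.
Variables (R : realType) (a : nat -> R).
Implicit Types A B : set posnat.

Lemma le_sum_over A B : A `<=` B -> (sum_over a A <= sum_over a B)%E.
Proof.
move=> AB; apply: ereal_sup_le => _ [F [Ffin FA] <-].
by exists F => //; split=> //; apply: subset_trans AB.
Qed.

Lemma sum_overU A B :
  (sum_over a (A `|` B) <= sum_over a A + sum_over a B)%E.
Proof.
apply: ge_ereal_sup => _ [F [Ffin FAB] <-].
rewrite (fsbigID A) //=; apply: leeD; apply: ereal_sup_ubound.
  exists (F `&` A) => //; split; first exact: finite_setIl.
  exact: subIsetr.
exists (F `&` ~` A) => //; split; first exact: finite_setIl.
by move=> n [/FAB[]].
Qed.

Lemma series_closed0 : series_closed a set0.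
Proof. by right; rewrite /sum_over esum_set0 ltry. Qed.

Lemma series_closedU A B :
  series_closed a A -> series_closed a B -> series_closed a (A `|` B).
Proof.
move=> [->|Afin]; first by left; rewrite setTU.
move=> [->|Bfin]; first by left; rewrite setUT.
by right; apply: le_lt_trans (sum_overU A B) _; exact: lte_add_pinfty.
Qed.

Lemma series_closed_bigI (I : Type) (F : I -> set posnat) :
  (forall i, series_closed a (F i)) -> series_closed a (\bigcap_i F i).
Proof.
move=> Fcl; have [[i Fi]|Ffin] := pselect (exists i, (sum_over a (F i) < +oo)%E).
  by right; apply: le_lt_trans Fi; apply: le_sum_over => n; exact.
left; rewrite -subTset => n _ i _.
by have [->|Fi] := Fcl i => //; case: Ffin; exists i.
Qed.

Let series_open (U : set posnat) : Prop := series_closed a (~` U).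

Let series_openT : series_open setT.
Proof. by rewrite /series_open setCT; exact: series_closed0. Qed.

Let series_openI : setI_closed series_open.
Proof.
by move=> U V oU oV; rewrite /series_open setCI; exact: series_closedU.
Qed.

Let series_open_bigU (I : Type) (F : I -> set posnat) :
  (forall i, series_open (F i)) -> series_open (\bigcup_i F i).
Proof.
by move=> oF; rewrite /series_open setC_bigcup; exact: series_closed_bigI.
Qed.

HB.instance Definition _ := Choice.copy (series_space a) posnat.
HB.instance Definition _ := isOpenTopological.Build (series_space a)
  series_openT series_openI series_open_bigU.

Lemma series_space_closedE (A : set (series_space a)) :
  closed A <-> series_closed a A.
Proof.
by rewrite -openC /open /= /series_open setCK.
Qed.

End SeriesTopology.

(* Main.v *)
Require Import Defs.
From mathcomp Require Import all_boot all_order all_algebra.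
From mathcomp Require Import all_classical all_reals.
From mathcomp Require Import ereal esum topology normedtype sequences.
Import Order.TTheory GRing.Theory Num.Theory.
Import numFieldNormedType.Exports.
Local Open Scope classical_set_scope.
Local Open Scope ring_scope.

(** If the total sum is infinite, a set and its complement cannot both have finite sum, by
    subadditivity ([sum_overU]), so no proper nonempty set is clopen. If it is finite, monotonicity
    ([le_sum_over]) makes every set closed: the space is discrete with at least two points.
    [cvg_sum_overT] translates convergence of partial sums into finiteness of the total sum. *)

Lemma posnat_succ_bij :
  set_bij [set: nat] [set: posnat] (fun n => exist _ n.+1 (ltn0Sn n)).
Proof.
split=> [//|m n _ _ [] //|[[//|n] n_gt0] _].
by exists n => //; exact: val_inj.
Qed.

(** Reindexing by the successor turns the unordered sum into a series over [nat]; with nonnegative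
    terms the two agree in the extended reals. *)
Lemma sum_overT (R : realType) (a : nat -> R) :
  (forall n, (0 < n)%N -> 0 <= a n) ->
  sum_over a setT = limn (EFin \o fun n => \sum_(1 <= k < n.+1) a k).
Proof.
move=> a_ge0.
rewrite /sum_over (reindex_esum _ _ _ _ posnat_succ_bij) -nneseries_esumT/=; last first.
  by move=> n; rewrite lee_fin a_ge0.
by apply/congr_lim/eq_fun => n /=; rewrite big_add1 sumEFin.
Qed.

Lemma cvg_sum_overT (R : realType) (a : nat -> R) :
  (forall n, (0 < n)%N -> 0 <= a n) ->
  cvgn (fun n => \sum_(1 <= k < n.+1) a k) <-> (sum_over a setT < +oo)%E.
Proof.
move=> a_ge0; rewrite sum_overT//; set S := fun n => _.
split=> [S_cvg|S_lty]; first by rewrite EFin_lim// ltry.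
have S_nd : nondecreasing_seq S.
  by apply/nondecreasing_seqP => n; rewrite /S (big_nat_recr n.+1)//= lerDl a_ge0.
have S_le n : ((S n)%:E <= limn (EFin \o S))%E.
  have ES_nd : nondecreasing_seq (EFin \o S).
    by move=> m p mp; rewrite lee_fin; exact: S_nd.
  rewrite (cvg_lim _ (ereal_nondecreasing_cvgn ES_nd))//.
  by apply: ereal_sup_ubound; exists n.
apply: nondecreasing_is_cvgn => //.
(* The extended limit is a real upper bound: [S_lty] excludes [+oo], and lying above the real [S n]
   excludes [-oo]. *)
exists (fine (limn (EFin \o S))) => _ [n _ <-].
by have := S_le n; case: (limn _) S_lty.
Qed.

Theorem theorem1p1 (R : realType) (a : nat -> R)
    (a_gt0 : forall n : nat, (0 < n)%N -> 0 < a n) :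
  ~ cvgn (fun n : nat => \sum_(1 <= k < n.+1) a k) <->
  connected [set: series_space a].
Proof.
rewrite cvg_sum_overT; last by move=> n /a_gt0/ltW.
split=> [sum_infty B [x Bx] [U oU] | conn sum_fin].
  rewrite setTI => BU [C cC]; rewrite setTI => BC.
  have /series_space_closedE[//|B_fin] : closed B by rewrite BC.
  have /series_space_closedE[CB_T|CB_fin] : closed (~` B).
    by rewrite BU; exact: open_closedC.
  - by have : (~` B) x by rewrite CB_T.
  - case: sum_infty; rewrite -(setUv B).
    by apply: le_lt_trans (sum_overU a B (~` B)) _; exact: lte_add_pinfty.
have all_closed (A : set (series_space a)) : closed A.
  apply/series_space_closedE; right.
  by apply: le_lt_trans sum_fin; exact: le_sum_over.
pose one : series_space a := exist _ 1%N isT.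
pose two : series_space a := exist _ 2%N isT.
(* Its complement is closed as well, so [[set one]] is clopen. *)
have one_T : [set one] = setT.
  apply: conn; first by exists one.
  - by exists [set one]; rewrite ?setTI// -closedC; exact: all_closed.
  - by exists [set one]; rewrite ?setTI.
by have : [set one] two by rewrite one_T.
Qed.
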